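(* Let $q$ be an even prime power and let $\mathcal{H}$ be a non-empty set of solids in $\mathrm{PG}(4,q)$ such that every point of $\mathrm{PG}(4,q)$ lies in either $0$, $\frac12 q^3$ or $\frac12(q^3+q^2)$ solids of $\mathcal{H}$. Let $\mathcal{K}$ be the set of points of $\mathrm{PG}(4,q)$ contained in exactly $\frac12(q^3+q^2)$ solids of $\mathcal{H}$. Then $\mathcal{K}$ is a quasi-quadric in $\mathrm{PG}(4,q)$, and $\mathcal{H}$ is the set of all solids of $\mathrm{PG}(4,q)$ that intersect $\mathcal{K}$ in $q^2+2q+1$ points.
   Context: A solid is a hyperplane of $\mathrm{PG}(4,q)$. Quasi-quadric means parabolic quasi-quadric: for $n=2m$ and $q$ even, a parabolic quasi-quadric with nucleus the point $N$ in $\mathrm{PG}(n,q)$ is a set $\mathcal{K}$ of $\frac{q^n-1}{q-1}$ points such that each line on $N$ contains a unique point of $\mathcal{K}$ and each hyperplane not on $N$ meets $\mathcal{K}$ in $\frac{(q^m+1)(q^{m-1}-1)}{q-1}$ or $\frac{(q^m-1)(q^{m-1}+1)}{q-1}$ points. For $n=4$ this means: $|\mathcal{K}|=q^3+q^2+q+1$, there is a point $N$ such that each line on $N$ contains a unique point of $\mathcal{K}$, and each solid not on $N$ meets $\mathcal{K}$ in $q^2+1$ or $(q+1)^2$ points. *)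

(* Defs.v *)
From HB Require Import structures.
From mathcomp Require Import all_boot all_order all_algebra.

Set Implicit Arguments.
Unset Strict Implicit.
Unset Printing Implicit Defensive.

Section FiniteVspace.

Import VectorInternalTheory.
Variables (F : finFieldType) (n : nat).

HB.instance Definition _ := [Countable of {vspace 'rV[F]_n} by <:].
HB.instance Definition _ := [Finite of {vspace 'rV[F]_n} by <:].

End FiniteVspace.

(* The subspaces of PG(n, #|F|) of vector-space dimension d, that is, of
   projective dimension d - 1. *)
Definition flat (F : finFieldType) (n d : nat) : predArgType :=
  {U : {vspace 'rV[F]_n.+1} | \dim U == d}.

HB.instance Definition _ (F : finFieldType) (n d : nat) :=
  Finite.on (flat F n d).

Notation point F n := (flat F n 1).
Notation line F n := (flat F n 2).
Notation hyperplane F n := (flat F n n).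
Notation solid F := (hyperplane F 4).

Definition incident (F : finFieldType) (n d e : nat)
    (U : flat F n d) (V : flat F n e) : bool :=
  (sval U <= sval V)%VS.

(* Here n = 2m with m = n./2, and all the divisions below are exact. *)
Definition parabolic_quasi_quadric_with_nucleus (F : finFieldType) (n : nat)
    (N : point F n) (K : {set point F n}) : Prop :=
  let q := #|F| in
  let m := n./2 in
  [/\ ~~ odd n /\ ~~ odd q,
      #|K| = (q ^ n - 1) %/ (q - 1),
      forall L : line F n, incident N L ->
        exists! P : point F n, P \in K /\ incident P L
    & forall S : hyperplane F n, ~~ incident N S ->
        let k := #|[set P in K | incident P S]| in
        k = ((q ^ m + 1) * (q ^ m.-1 - 1)) %/ (q - 1) \/
        k = ((q ^ m - 1) * (q ^ m.-1 + 1)) %/ (q - 1)].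

Definition parabolic_quasi_quadric (F : finFieldType) (n : nat)
    (K : {set point F n}) : Prop :=
  exists N : point F n, parabolic_quasi_quadric_with_nucleus N K.

(* Main.v *)
Require Import Defs.
From mathcomp Require Import all_boot all_order all_algebra all_field.
From mathcomp Require Import zify ring.

(** Call the degree of a point the number of solids of H through it.  The proof
    is double counting; three sums of degrees carry all the information, and
    they see nothing of H but its size and, in the second, one membership:
      - over all points, [sum_degree_full];
      - over the points of a solid S, which is larger by q^3 when S belongs to
        H, [sum_degree_hyperplane];
      - over the points of a line through a point of degree 0, which every solid
        of H meets in exactly one point, [sum_degree_line].
    Adding the second over the solids of H gives the sum of the squares of the
    degrees, [sum_degree_sqr].

    Put c = q^2 / 2.  The three admissible degrees are 0, c q and c (q + 1), all
    multiples of c, and the number of points of a solid is prime to c, so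
    |H| = c y for some y, [dvd_half_q2_card].  The sums of the degrees and of
    their squares then express the numbers of points of each degree through y
    and q.  That these numbers are nonnegative integers forces
    q^2 < y < q^2 + q, and makes y (y - 1) a multiple of q.  As q is a prime
    power, y is 0 or 1 modulo q, hence y = q^2 + 1,
    [standard_equations_solution].

    Now |K| = q^3 + q^2 + q + 1 and exactly one point N has degree 0.  As all
    other degrees are known up to membership in K, the sum of the degrees over
    a subspace determines how many points of K it contains: 1 for a line
    through N, [card_line_K], and for a solid a number that reveals whether it
    contains N and whether it belongs to H, [card_solid_K].  Both claims of the
    theorem can be read off from these two counts. *)

Set Implicit Arguments.
Unset Strict Implicit.
Unset Printing Implicit Defensive.

(** * Points of a projective subspace *)

(** The number of points of PG(d - 1, q), written as a sum so as to avoid the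
    division by q - 1. *)
Definition num_points (q d : nat) : nat := \sum_(i < d) q ^ i.

Lemma num_pointsS q d : num_points q d.+1 = num_points q d + q ^ d.
Proof. exact: big_ord_recr. Qed.

Section Counting.

Variables (F : finFieldType) (n : nat).
Implicit Types (U : {vspace 'rV[F]_n.+1}) (H : {set hyperplane F n}).
Local Notation q := #|F|.

Definition points_in U : {set point F n} := [set P | (sval P <= U)%VS].

Definition degree H (P : point F n) : nat := #|[set S in H | incident P S]|.

Lemma card_nonzero U : #|[set v in U | v != 0%R]| = q.-1 * num_points q (\dim U).
Proof.
have := cardsD1 0%R [set v in U].
rewrite cardsE card_vspace inE (mem0v U) add1n -predn_exp => -> /=.
by apply: eq_card => v; rewrite !inE andbC.
Qed.

(** Every nonzero vector of U spans exactly one point of U, and every point is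
    spanned by q - 1 of its vectors. *)
Lemma card_points_in U : #|points_in U| = num_points q (\dim U).
Proof.
have q1_gt0 : 0 < q.-1 by rewrite -subn1 subn_gt0 finNzRing_gt1.
apply/eqP; rewrite -(eqn_pmul2l q1_gt0) -card_nonzero; apply/eqP.
transitivity (\sum_(P in points_in U) #|[set v in sval P | v != 0%R]|).
  rewrite (eq_bigr (fun=> q.-1)) ?sum_nat_const 1?mulnC // => P _.
  by rewrite card_nonzero (eqP (valP P)) /num_points big_ord1 expn0 muln1.
under eq_bigr => P _ do rewrite -sum1dep_card.
rewrite (exchange_big_dep [in [set v in U | v != 0%R]]) /=; last first.
  move=> P v; rewrite !inE => PU /andP[vP ->]; rewrite andbT.
  exact: subvP PU _ vP.
rewrite -sum1_card; apply: eq_bigr => v; rewrite inE => /andP[vU v0].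
have dimv : \dim <[v]> == 1 by rewrite dim_vline v0.
pose Pv : point F n := exist (fun V : {vspace 'rV[F]_n.+1} => \dim V == 1) _ dimv.
rewrite (big_pred1 Pv) // => P; rewrite !inE v0 andbT.
apply/andP/eqP => [[PU vP]|->]; last by rewrite -memvE memv_line.
apply/val_inj/esym/eqP => /=; rewrite eqEdim (eqP dimv) (eqP (valP P)).
by rewrite -memvE vP.
Qed.

Lemma dim_cap_hyperplane U (S : hyperplane F n) : ~~ (U <= sval S)%VS ->
  (\dim (U :&: sval S)).+1 = \dim U.
Proof.
move=> nUS; have := dimv_sum_cap U (sval S).
have -> : \dim (U + sval S) = n.+1.
  apply/eqP; rewrite eqn_leq; apply/andP; split.
    by rewrite (leq_trans (dimvS (subvf _))) // dimvf /dim /= mul1n.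
  rewrite -{1}(eqP (valP S)) ltn_neqAle dimvS ?addvSr // andbT.
  apply: contra nUS => /eqP dimE; rewrite (_ : sval S = (U + sval S)%VS) ?addvSl //.
  by apply/eqP; rewrite eqEdim addvSr -dimE /=.
by rewrite (eqP (valP S)); lia.
Qed.

(** * Sums of degrees *)

(** Both sides count the incident pairs of a point of U and an element of H. *)
Lemma sum_degree H U :
  \sum_(P in points_in U) degree H P =
  \sum_(S in H) num_points q (\dim (U :&: sval S)).
Proof.
under eq_bigr => P _ do rewrite /degree -sum1dep_card.
rewrite (exchange_big_dep [in H]) /=; last by move=> P S _ /andP[].
apply: eq_bigr => S SH; rewrite -card_points_in -sum1_card.
by apply: eq_bigl => P; rewrite !inE SH subv_cap.
Qed.

Lemma sum_degree_full H :
  \sum_P degree H P = #|H| * num_points q n.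
Proof.
rewrite (eq_bigl [in points_in fullv]) => [|P]; last by rewrite inE subvf.
rewrite sum_degree -sum_nat_const; apply: eq_bigr => S _.
by rewrite capfv (eqP (valP S)).
Qed.

(** Two distinct hyperplanes meet in codimension 2, so each element of H other
    than S contributes the same number of points; S itself contributes q^(n-1)
    points more. *)
Lemma sum_degree_hyperplane H (S : hyperplane F n) : 0 < n ->
  \sum_(P in points_in (sval S)) degree H P =
  #|H| * num_points q n.-1 + (S \in H) * q ^ n.-1.
Proof.
move=> n_gt0; rewrite sum_degree -sum_nat_const.
rewrite (eq_bigr (fun S' => num_points q n.-1 + (S' == S) * q ^ n.-1)).
  rewrite big_split /=; congr (_ + _); rewrite -big_distrl /=; congr (_ * _).
  rewrite big_mkcond (bigD1 S) //= eqxx big1 ?addn0; first by case: ifP.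
  by move=> S' /negPf->; case: ifP.
move=> S' _; have [->|neqSS'] := eqVneq S' S.
  by rewrite capvv (eqP (valP S)) mul1n -num_pointsS prednK.
rewrite mul0n addn0; congr num_points.
rewrite -[LHS]/(_.+1.-1) dim_cap_hyperplane ?(eqP (valP S)) //.
apply: contra neqSS' => SS'; apply/eqP/val_inj/esym/eqP; rewrite eqEdim SS' /=.
by rewrite (eqP (valP S)) (eqP (valP S')).
Qed.

(** The square of the degree of P counts the incident pairs (P, S) with S in H,
    each with weight the degree of P; collecting them by S leaves the sums of
    degrees over the elements of H. *)
Lemma sum_degree_sqr H : 0 < n ->
  \sum_P degree H P ^ 2 = #|H| * (#|H| * num_points q n.-1 + q ^ n.-1).
Proof.
move=> n_gt0; rewrite -sum_nat_const.
under eq_bigr => P _ do rewrite -mulnn {1}/degree -sum1dep_card big_distrl /=.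
rewrite (exchange_big_dep [in H]) /=; last by move=> P S _ /andP[].
apply: eq_bigr => S SH.
have := sum_degree_hyperplane H S n_gt0; rewrite SH mul1n => <-.
apply: eq_big => [P|P _]; last by rewrite mul1n.
by rewrite !inE.
Qed.

(** No element of H contains L, because none contains P; each therefore meets L
    in a single point and is counted once. *)
Lemma sum_degree_line H (L : line F n) (P : point F n) :
  incident P L -> degree H P = 0 ->
  \sum_(R in points_in (sval L)) degree H R = #|H|.
Proof.
move=> PL /eqP; rewrite cards_eq0 => /eqP degP0.
rewrite sum_degree -sum1_card; apply: eq_bigr => S SH.
have nLS : ~~ (sval L <= sval S)%VS.
  apply/negP => LS; have := in_set0 S; rewrite -degP0 inE SH.
  by rewrite /incident (subv_trans PL LS).
have [->] : (\dim (sval L :&: sval S)).+1 = 2.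
  by rewrite dim_cap_hyperplane ?(eqP (valP L)).
by rewrite /num_points big_ord1.
Qed.

End Counting.

(** * Solving the standard equations *)

Lemma finField_prime_power (F : finFieldType) :
  exists p k, prime p /\ #|F| = p ^ k.
Proof.
have [p p_prime pcharF] := finPcharP F.
by exists p, (logn p #|F|); split=> //; apply: card_pprimeChar pcharF.
Qed.

Lemma prime_power_dvd_consecutive p k y : prime p ->
  p ^ k %| y * y.-1 -> (p ^ k %| y) || (p ^ k %| y.-1).
Proof.
move=> p_prime; case: y => [|y] /=; first by rewrite dvdn0.
have [p_y dvd_prod | not_p_y] := boolP (p %| y).
  apply/orP; right; rewrite -(@Gauss_dvdr _ y.+1) // coprimeXl //.
  by rewrite prime_coprime // -addn1 dvdn_addr // Euclid_dvd1.
by rewrite Gauss_dvdl ?coprimeXl ?prime_coprime // => ->.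
Qed.

(** Here c y is the size of H, M the number of points of nonzero degree and B
    the size of K; the two equations are the sums of the degrees, divided by c,
    and of their squares, divided by c^2. *)
Lemma standard_equations_solution p k q y M B :
    prime p -> q = p ^ k -> 1 < q -> 0 < y -> B <= M ->
    q * M + B = y * (q ^ 3 + q ^ 2 + q + 1) ->
    q ^ 2 * M + (2 * q + 1) * B = y * (y * (q ^ 2 + q + 1) + 2 * q) ->
  [/\ y = q ^ 2 + 1, B = q ^ 3 + q ^ 2 + q + 1
    & M = q ^ 4 + q ^ 3 + q ^ 2 + q].
Proof.
move=> p_prime qE q_gt1 y_gt0 /subnKC; move: (M - B) => A <- E1 E2.
have := @prime_power_dvd_consecutive p k y p_prime; rewrite -qE => dvdq.
(* With A the number of points of degree c q, eliminating A gives
   (q + 1) B = y ((y - q^2) (q^2 + q + 1) + q), and eliminating B gives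
   q A = y ((q^2 + q - y) (q^2 + q + 1) - q + 1). *)
have eqB : (q + 1) * B + y * (q ^ 2 * (q ^ 2 + q + 1)) =
           y * (y * (q ^ 2 + q + 1) + q).
  by have := congr1 (muln q) E1; lia.
have eqA : q * A + y * (y * (q ^ 2 + q + 1) + q) =
           y * ((q ^ 2 + q) * (q ^ 2 + q + 1) + 1).
  by have := congr1 (muln (q + 1)) E1; lia.
clear E1 E2.
have y_gt : q ^ 2 < y.
  rewrite ltnNge leq_eqVlt; apply/norP; split.
    (* If y = q^2, then q + 1 divides q^3, to which it is coprime. *)
    apply/eqP => yE.
    have /esym cubeE : (q + 1) * B = q ^ 3 by rewrite yE in eqB; lia.
    have : q + 1 %| q ^ 3 by rewrite cubeE dvdn_mulr.
    have co : coprime (q + 1) (q ^ 3) by rewrite coprimeXr // addn1 coprimeSn.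
    by rewrite -[q ^ 3]muln1 Gauss_dvdr // dvdn1; lia.
  (* If y < q^2, then B would be negative. *)
  apply/negP => y_lt.
  suff : y * (y * (q ^ 2 + q + 1) + q) < y * (q ^ 2 * (q ^ 2 + q + 1)) by lia.
  rewrite ltn_pmul2l //.
  have : y.+1 * (q ^ 2 + q + 1) <= q ^ 2 * (q ^ 2 + q + 1) by rewrite leq_mul.
  by clear eqA eqB; lia.
have y_lt : y < q ^ 2 + q.
  (* If y >= q^2 + q, then A would be negative. *)
  rewrite ltnNge; apply/negP => y_ge.
  suff : y * ((q ^ 2 + q) * (q ^ 2 + q + 1) + 1) <
         y * (y * (q ^ 2 + q + 1) + q) by lia.
  rewrite ltn_pmul2l //.
  have : (q ^ 2 + q) * (q ^ 2 + q + 1) <= y * (q ^ 2 + q + 1) by rewrite leq_mul.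
  by clear eqA eqB; lia.
(* The relation eqA modulo q, where q^2 + q + 1 is 1. *)
have /dvdq y_or_y1 : q %| y * y.-1.
  rewrite -(@dvdn_addl (q * (A + y * (y * (q + 1) + 1)))) ?dvdn_mulr //.
  apply/dvdnP; exists (y * (q + 1) * (q ^ 2 + q + 1)).
  move: eqA; rewrite -(prednK y_gt0) /=; move: y.-1 => z eqA.
  apply: (@addIn z.+1).
  rewrite [LHS](_ : _ = q * A + z.+1 * (z.+1 * (q ^ 2 + q + 1) + q)); last ring.
  by rewrite eqA; ring.
have q_gt0 : 0 < q by exact: ltnW.
have yE : y = q ^ 2 + 1.
  case/orP: y_or_y1 => /dvdnP[z zE].
    (* No multiple of q lies strictly between q^2 and q^2 + q. *)
    have ltqz : q < z by rewrite -(@ltn_pmul2r q) // -zE mulnn.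
    have : q.+1 * q <= z * q by rewrite leq_mul.
    by rewrite -zE; clear eqA eqB; lia.
  have leqz : q <= z by rewrite -(@leq_pmul2r q) // -zE mulnn -ltnS prednK.
  have ltzq : z < q.+1.
    rewrite -(@ltn_pmul2r q) // -zE mulSn mulnn addnC.
    by rewrite (leq_ltn_trans (leq_pred y)).
  have zq : z = q by apply/eqP; rewrite eqn_leq leqz -ltnS ltzq.
  by rewrite -(prednK y_gt0) zE zq mulnn addn1.
have BE : B = q ^ 3 + q ^ 2 + q + 1.
  apply/eqP; rewrite -(@eqn_pmul2l (q + 1)) ?addn1 // -addn1; apply/eqP.
  by rewrite yE in eqB; clear eqA; lia.
have AE : A + 1 = q ^ 4.
  apply/eqP; rewrite -(@eqn_pmul2l q) //; apply/eqP.
  by rewrite yE in eqA; clear eqB; lia.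
by split=> //; clear -BE AE; lia.
Qed.

(** * The sizes of H and K *)

Lemma sum_indicators (T : finType) (D M K : {set T}) (d : T -> nat) (a b : nat) :
    (forall P, d P = a * (P \in M) + b * (P \in K)) ->
  \sum_(P in D) d P = a * #|D :&: M| + b * #|D :&: K|.
Proof.
have count_mem (A : {set T}) : \sum_(P in D) (P \in A : nat) = #|D :&: A|.
  rewrite -sum1_card big_mkcond [RHS]big_mkcond; apply: eq_bigr => P _.
  by rewrite inE; case: (P \in D); case: (P \in A).
move=> dE; under eq_bigr => P _ do rewrite dE.
by rewrite big_split -!big_distrr /= !count_mem.
Qed.

Section HyperbolicSolids.

Variables (F : finFieldType) (H : {set solid F}) (c : nat).
Local Notation q := #|F|.
Local Notation deg := (degree H).

Hypothesis q2E : q ^ 2 = 2 * c.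
Hypothesis H_neq0 : H != set0.
Hypothesis deg_three_valued : forall P,
  [\/ deg P = 0, deg P = q ^ 3 %/ 2 | deg P = (q ^ 3 + q ^ 2) %/ 2].

Let K : {set point F 4} := [set P | deg P == (q ^ 3 + q ^ 2) %/ 2].
(* The complement of M turns out to be the nucleus alone. *)
Let M : {set point F 4} := [set P | deg P != 0].

Let q_gt1 : 1 < q. Proof. exact: finNzRing_gt1. Qed.

Let q3E : q ^ 3 = 2 * c * q.
Proof. by rewrite expnSr q2E. Qed.

Let c_gt0 : 0 < c.
Proof. have : 0 < q ^ 2 by rewrite expn_gt0 ltnW. by rewrite q2E; lia. Qed.

Let half_q3 : q ^ 3 %/ 2 = c * q.
Proof. by rewrite q3E -mulnA mulKn. Qed.

Let half_q3q2 : (q ^ 3 + q ^ 2) %/ 2 = c * (q + 1).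
Proof. by rewrite q3E q2E -mulnA -mulnDr mulKn // mulnDr muln1. Qed.

(** The two larger degrees are c q and c q + c, so the degree is a combination
    of two indicator functions and can be summed over any set of points. *)
Lemma deg_decomposition P : deg P = c * q * (P \in M) + c * (P \in K).
Proof.
rewrite !inE; have := deg_three_valued P; rewrite half_q3 half_q3q2.
by case=> ->; rewrite ?eqn_pmul2l ?muln_eq0; lia.
Qed.

Lemma K_sub_M : K \subset M.
Proof.
apply/subsetP => P; rewrite !inE half_q3q2 => /eqP ->.
by rewrite muln_eq0; lia.
Qed.

Let num_points2 : num_points q 2 = q + 1.
Proof. by rewrite /num_points !big_ord_recr big_ord0 /=; lia. Qed.

Let num_points3 : num_points q 3 = q ^ 2 + q + 1.
Proof. by rewrite num_pointsS num_points2; lia. Qed.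

Let num_points4 : num_points q 4 = q ^ 3 + q ^ 2 + q + 1.
Proof. by rewrite num_pointsS num_points3; lia. Qed.

Let num_points5 : num_points q 5 = q ^ 4 + q ^ 3 + q ^ 2 + q + 1.
Proof. by rewrite num_pointsS num_points4; lia. Qed.

(** c divides every degree, hence |H| (q^3 + q^2 + q + 1); and c divides q^2,
    which is prime to the second factor. *)
Lemma dvd_half_q2_card : c %| #|H|.
Proof.
have co : coprime c (num_points q 4).
  apply: (@coprime_dvdl _ (q ^ 2)); first by rewrite q2E dvdn_mull.
  rewrite coprimeXl // num_points4 (_ : _ + 1 = (q ^ 2 + q + 1) * q + 1); last lia.
  by rewrite /coprime gcdnMDl gcdn1.
rewrite -(Gauss_dvdl _ co) -sum_degree_full.
apply: dvdn_sum => P _.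
by rewrite deg_decomposition dvdn_add // -?mulnA dvdn_mulr.
Qed.

Lemma card_H_K_M :
  [/\ #|H| = c * (q ^ 2 + 1), #|K| = q ^ 3 + q ^ 2 + q + 1
    & #|M| = q ^ 4 + q ^ 3 + q ^ 2 + q].
Proof.
have [y HE] : exists y, #|H| = c * y.
  by have /dvdnP[y ->] := dvd_half_q2_card; exists y; rewrite mulnC.
have y_gt0 : 0 < y.
  by have := H_neq0; rewrite -card_gt0 HE muln_gt0 => /andP[].
have [p [k [p_prime qE]]] := finField_prime_power F.
have E1 : q * #|M| + #|K| = y * (q ^ 3 + q ^ 2 + q + 1).
  apply/eqP; rewrite -(eqn_pmul2l c_gt0) mulnA -HE -num_points4 -sum_degree_full.
  rewrite mulnDr mulnA -(setTI M) -(setTI K) -(sum_indicators _ deg_decomposition).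
  by apply/eqP/eq_bigl => P; rewrite inE.
have E2 : q ^ 2 * #|M| + (2 * q + 1) * #|K| = y * (y * (q ^ 2 + q + 1) + 2 * q).
  (* K lies in M, so c^2 (q + 1)^2 = c^2 q^2 + c^2 (2 q + 1) on K. *)
  have degsqE P : deg P ^ 2 = c ^ 2 * q ^ 2 * (P \in M) +
                              c ^ 2 * (2 * q + 1) * (P \in K).
    rewrite deg_decomposition; have /subsetP/(_ P) := K_sub_M.
    by case: (P \in K) => [/(_ isT)->|_]; [|case: (P \in M)];
       rewrite ?muln1 ?muln0; ring.
  have c2_gt0 : 0 < c ^ 2 by rewrite expn_gt0 c_gt0.
  apply/eqP; rewrite -(eqn_pmul2l c2_gt0); apply/eqP.
  have := @sum_degree_sqr F 4 H isT; rewrite num_points3 q3E HE.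
  rewrite [LHS](_ : _ = \sum_(P in [set: point F 4]) deg P ^ 2); last first.
    by apply: eq_bigl => P; rewrite inE.
  rewrite (sum_indicators _ degsqE) !setTI => sqrE.
  transitivity (c ^ 2 * q ^ 2 * #|M| + c ^ 2 * (2 * q + 1) * #|K|); first ring.
  by rewrite sqrE; ring.
have [yE KE ME] := standard_equations_solution p_prime qE q_gt1 y_gt0
                     (subset_leq_card K_sub_M) E1 E2.
by rewrite HE yE.
Qed.

(** * The nucleus and the intersections with K *)

Lemma exists_nucleus : exists N, ~: M = [set N].
Proof.
have card_PG : #|{: point F 4}| = q ^ 4 + q ^ 3 + q ^ 2 + q + 1.
  rewrite -cardsT (_ : [set: point F 4] = points_in fullv); last first.
    by apply/setP => P; rewrite !inE subvf.
  by rewrite card_points_in dimvf /dim /= mul1n num_points5.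
apply/cards1P; have [_ _ ME] := card_H_K_M.
by have := cardsC M; rewrite ME card_PG => /addnI ->.
Qed.

Section Nucleus.

Variable N : point F 4.
Hypothesis N_nucleus : ~: M = [set N].

Lemma deg_nucleus : deg N = 0.
Proof.
by apply/eqP; have := set11 N; rewrite -N_nucleus !inE negbK.
Qed.

Lemma card_points_in_M (U : {vspace 'rV[F]_5}) :
  #|points_in U :&: M| + (sval N <= U)%VS = num_points q (\dim U).
Proof.
rewrite -card_points_in -[RHS](cardsID M) setDE N_nucleus; congr (_ + _).
have [NU|nNU] := boolP (sval N <= U)%VS.
  by rewrite (setIidPr _) ?cards1 // sub1set inE.
by apply/esym/eqP; rewrite cards_eq0 setI_eq0 disjoint_sym disjoints1 inE.
Qed.

Lemma sum_degree_K (U : {vspace 'rV[F]_5}) :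
  \sum_(P in points_in U) deg P =
  c * (q * #|points_in U :&: M| + #|points_in U :&: K|).
Proof. by rewrite (sum_indicators _ deg_decomposition) mulnDr mulnA. Qed.

(** The degrees on L add up to |H| = c (q^2 + 1); the q points other than N
    account for c q^2, and each point of K adds a further c. *)
Lemma card_line_K (L : line F 4) : incident N L ->
  #|points_in (sval L) :&: K| = 1.
Proof.
move=> NL; have := sum_degree_line NL deg_nucleus.
have [-> _ _] := card_H_K_M; rewrite sum_degree_K => /eqP.
rewrite (eqn_pmul2l c_gt0) => /eqP.
have := card_points_in_M (sval L).
rewrite (eqP (valP L)) num_points2 -/(incident N L) NL /=.
by move=> /addIn ->; rewrite mulnn => /addnI.
Qed.

(** In units of c, the degrees on S add up to
    (q^2 + 1) (q^2 + q + 1) + 2 q [S in H]; the points other than N account for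
    q (q^3 + q^2 + q + 1 - [N in S]), and the rest comes from K. *)
Lemma card_solid_K (S : solid F) :
  #|points_in (sval S) :&: K| = q ^ 2 + 1 + q * incident N S + 2 * q * (S \in H).
Proof.
have := sum_degree_hyperplane H S isT.
have [-> _ _] := card_H_K_M; rewrite sum_degree_K num_points3 q3E => eqS.
have {eqS} : q * #|points_in (sval S) :&: M| + #|points_in (sval S) :&: K| =
    (q ^ 2 + 1) * (q ^ 2 + q + 1) + 2 * q * (S \in H).
  by apply/eqP; rewrite -(eqn_pmul2l c_gt0) eqS; apply/eqP; ring.
have := card_points_in_M (sval S).
rewrite (eqP (valP S)) num_points4 -/(incident N S) => /(congr1 (muln q)); lia.
Qed.

Lemma nucleus_not_in_H (S : solid F) : S \in H -> ~~ incident N S.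
Proof.
move=> SH; apply/negP => NS; have /eqP := deg_nucleus.
by rewrite cards_eq0 => /eqP/setP/(_ S); rewrite !inE SH NS.
Qed.

End Nucleus.

Lemma points_inI n d (S : flat F n d) (A : {set point F n}) :
  [set P in A | incident P S] = points_in (sval S) :&: A.
Proof. by apply/setP => P; rewrite !inE andbC. Qed.

Lemma K_quasi_quadric : parabolic_quasi_quadric K.
Proof.
have q1_gt0 : 0 < q - 1 by rewrite subn_gt0.
have [N N_nucleus] := exists_nucleus; exists N; split.
- by have := congr1 odd q2E; rewrite oddX mul2n odd_double /= => ->.
- have [_ -> _] := card_H_K_M.
  rewrite subn1 predn_exp -subn1 mulKn //; exact/esym/num_points4.
- move=> L NL; have /eqP/cards1P[P PE] := card_line_K N_nucleus NL.
  have inP R : (R \in K) && incident R L = (R == P).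
    by move/setP: PE => /(_ R); rewrite !inE andbC.
  exists P; split; first by apply/andP; rewrite inP.
  by move=> R /andP; rewrite inP => /eqP.
move=> S nNS /=; rewrite points_inI (card_solid_K N_nucleus) (negPf nNS).
rewrite !expn1 muln0 addn0.
have -> : (q ^ 2 + 1) * (q - 1) = (q - 1) * (q ^ 2 + 1) by rewrite mulnC.
have -> : (q ^ 2 - 1) * (q + 1) = (q - 1) * (q ^ 2 + 2 * q + 1).
  by rewrite -[in q ^ 2 - 1](exp1n 2) subn_sqr; ring.
by rewrite !mulKn //; case: (S \in H); [right | left]; lia.
Qed.

(** A solid of H does not contain N, so it meets K in (q + 1)^2 points; the other solids
    meet K in q^2 + 1 or q^2 + q + 1 points. *)
Lemma H_from_K :
  H = [set S : solid F | #|[set P in K | incident P S]| == q ^ 2 + 2 * q + 1].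
Proof.
have [N N_nucleus] := exists_nucleus; apply/setP => S; rewrite inE.
rewrite points_inI (card_solid_K N_nucleus).
have [SH|_] := boolP (S \in H).
  by rewrite (negPf (nucleus_not_in_H N_nucleus SH)); apply/esym/eqP; lia.
by apply/esym/eqP; case: (incident N S); lia.
Qed.

End HyperbolicSolids.

Theorem theorem1p6 (F : finFieldType) (q : nat) (card_F : #|F| = q)
  (q_even : ~~ odd q) (H : {set solid F}) (H_neq0 : H != set0)
  (H_deg : forall P : point F 4,
     [\/ #|[set S in H | incident P S]| = 0,
         #|[set S in H | incident P S]| = q ^ 3 %/ 2
       | #|[set S in H | incident P S]| = (q ^ 3 + q ^ 2) %/ 2]) :
  let K := [set P : point F 4 |
              #|[set S in H | incident P S]| == (q ^ 3 + q ^ 2) %/ 2] in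
  parabolic_quasi_quadric K /\
  H = [set S : solid F |
         #|[set P in K | incident P S]| == q ^ 2 + 2 * q + 1].
Proof.
move: q_even H_deg; rewrite -card_F => F_even H_degF.
have q2E : #|F| ^ 2 = 2 * (#|F| ^ 2 %/ 2).
  by rewrite mulnC divnK // dvdn2 oddX negb_or F_even.
split; first exact: K_quasi_quadric q2E H_neq0 H_degF.
exact: H_from_K q2E H_neq0 H_degF.
Qed.
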